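(* Let $k^*$ be a feasible point of the MPEC satisfying the GA-stationarity condition with multipliers $\lambda=(\lambda^\ell,\lambda^\hbar,\lambda^G,\lambda^H)$ and $\mu=(\mu^\hbar,\mu^G,\mu^H)$. Define $$\Omega_\mu^G=\{i\in\Omega:\mu_i^H=0,\ \mu_i^G>0\},\quad \Omega_\mu^H=\{i\in\Omega:\mu_i^G=0,\ \mu_i^H>0\},\quad \Theta_\mu^+=\{i\in\Theta:\mu_i^G>0\},\quad \Upsilon_\mu^+=\{i\in\Upsilon:\mu_i^H>0\}.$$ Suppose that $\mathcal{J}$ is $\partial^T$-pseudoconvex at $k^*$ and that $\ell_i$ ($i\in I_\ell$), $\hbar_i$ and $-\hbar_i$ ($i=1,\dots,q$), $-G_i$ ($i\in\Theta\cup\Omega$) and $-H_i$ ($i\in\Upsilon\cup\Omega$) are $\partial^T$-quasiconvex at $k^*$. If $\Omega_\mu^G\cup\Omega_\mu^H\cup\Theta_\mu^+\cup\Upsilon_\mu^+=\emptyset$, then $k^*$ is a global optimal solution of the MPEC.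
   Context: **Tangential convexity.** A function $f:\mathbb{R}^n\to\mathbb{R}$ is tangentially convex at $k$ if for every $d\in\mathbb{R}^n$ the one-sided directional derivative $f'(k,d)=\lim_{h\downarrow 0}\frac{f(k+hd)-f(k)}{h}$ exists and is finite, and $d\mapsto f'(k,d)$ is convex. Its tangential subdifferential at $k$ is $\partial^T f(k)=\{\xi\in\mathbb{R}^n:\langle \xi,d\rangle\le f'(k,d)\ \forall d\in\mathbb{R}^n\}$ (a nonempty compact convex set with $f'(k,d)=\max_{\xi\in\partial^T f(k)}\langle\xi,d\rangle$). Wherever $\partial^T(-f)(k)$ is written, $-f$ is assumed tangentially convex at $k$. **Generalized convexity.** $f$, tangentially convex at $k$, is $\partial^T$-pseudoconvex at $k$ if for all $t\in\mathbb{R}^n$: $f(t)<f(k)$ implies $\langle\xi,t-k\rangle<0$ for all $\xi\in\partial^T f(k)$. It is $\partial^T$-quasiconvex at $k$ if for all $t\in\mathbb{R}^n$: $f(t)\le f(k)$ implies $\langle\xi,t-k\rangle\le0$ for all $\xi\in\partial^T f(k)$. **The problem.** MPEC: minimize $\mathcal{J}(k)$ subject to $\ell(k)\le 0$, $\hbar(k)=0$, $G(k)\ge 0$, $H(k)\ge 0$, $\langle G(k),H(k)\rangle=0$, where $\mathcal{J}:\mathbb{R}^n\to\mathbb{R}$, $\ell:\mathbb{R}^n\to\mathbb{R}^p$, $\hbar:\mathbb{R}^n\to\mathbb{R}^q$, $G,H:\mathbb{R}^n\to\mathbb{R}^m$; all (component) functions are tangentially convex at $k^*$. $K$ is the feasible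 set. For $k^*\in K$: $I_\ell=\{i:\ell_i(k^* )=0\}$, $\Theta=\{i:G_i(k^* )=0,H_i(k^* )>0\}$, $\Omega=\{i:G_i(k^* )=0,H_i(k^* )=0\}$, $\Upsilon=\{i:G_i(k^* )>0,H_i(k^* )=0\}$. Standing assumption: $\Omega\neq\emptyset$. **GA-stationarity of a feasible point $k^*$ with multipliers** $\lambda=(\lambda^\ell,\lambda^\hbar,\lambda^G,\lambda^H)\in\mathbb{R}^{p+q+2m}$, $\mu=(\mu^\hbar,\mu^G,\mu^H)\in\mathbb{R}^{q+2m}$ means: $$0\in\partial^T\mathcal{J}(k^* )+\sum_{i\in I_\ell}\lambda_i^\ell\partial^T\ell_i(k^* )+\sum_{j=1}^q[\lambda_j^\hbar\partial^T\hbar_j(k^* )+\mu_j^\hbar\partial^T(-\hbar_j)(k^* )]+\sum_{i=1}^m[\lambda_i^G\partial^T(-G_i)(k^* )+\lambda_i^H\partial^T(-H_i)(k^* )]+\sum_{i=1}^m[\mu_i^G\partial^TG_i(k^* )+\mu_i^H\partial^TH_i(k^* )],$$ $\lambda_i^\ell\ge0$ ($i\in I_\ell$), $\lambda_j^\hbar,\mu_j^\hbar\ge0$ ($j=1,\dots,q$), $\lambda_i^G,\lambda_i^H,\mu_i^G,\mu_i^H\ge0$ ($i=1,\dots,m$), $\mu_i^G=\lambda_i^G=0$ for $i\in\Upsilon$, $\mu_i^H=\lambda_i^H=0$ for $i\in\Theta$, and for every $i\in\Omega$: $\mu_i^G=0$ or $\mu_i^H=0$. Terms with zero multiplier are $\{0\}$.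 *)

(* Defs.v *)
From HB Require Import structures.
From mathcomp Require Import all_boot all_order all_algebra.
From mathcomp Require Import all_classical all_reals all_analysis.

Set Implicit Arguments.
Unset Strict Implicit.
Unset Printing Implicit Defensive.

Import Order.TTheory GRing.Theory Num.Theory.
Import numFieldNormedType.Exports.

Local Open Scope classical_set_scope.
Local Open Scope ring_scope.

Definition dotprod (R : realType) (n : nat) (u v : 'rV[R]_n) : R :=
  \sum_(i < n) u 0 i * v 0 i.

Definition component (R : realType) (n r : nat) (F : 'rV[R]_n -> 'rV[R]_r)
  (i : 'I_r) : 'rV[R]_n -> R := fun k => F k 0 i.

Section TangentialConvexity.
Variables (R : realType) (n : nat).
Implicit Types (f : 'rV[R]_n -> R) (k d : 'rV[R]_n).

Definition diff_quotient f k d : R -> R := fun h => (f (k + h *: d) - f k) / h.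

(* Meaningful only when the limit exists; [tangentially_convex] requires it. *)
Definition dir_deriv f k d : R := lim (diff_quotient f k d h @[h --> 0^'+]).

Definition tangentially_convex f k : Prop :=
  (forall d, cvg (diff_quotient f k d h @[h --> 0^'+])) /\
  convex_function setT (dir_deriv f k).

Definition tangential_subdiff f k : set 'rV[R]_n :=
  [set xi | forall d, dotprod xi d <= dir_deriv f k d].

Definition tangentially_pseudoconvex f k : Prop :=
  tangentially_convex f k /\
  forall t, f t < f k ->
    forall xi, tangential_subdiff f k xi -> dotprod xi (t - k) < 0.

Definition tangentially_quasiconvex f k : Prop :=
  tangentially_convex f k /\
  forall t, f t <= f k ->
    forall xi, tangential_subdiff f k xi -> dotprod xi (t - k) <= 0.

End TangentialConvexity.

Definition minkowski_add (V : zmodType) (A B : set V) : set V :=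
  [set a + b | a in A & b in B].

(* By convention 0 * A = {0}, even when A is empty. *)
Definition minkowski_scale (R : realType) (V : lmodType R) (a : R) (A : set V) :
    set V :=
  if a == 0 then [set 0] else [set a *: x | x in A].

Declare Scope minkowski_scope.
Delimit Scope minkowski_scope with MK.
Notation "A + B" := (minkowski_add A B) : minkowski_scope.
Notation "a *: A" := (minkowski_scale a%R A) : minkowski_scope.
Notation "\sum_ ( i < n ) A" :=
  (\big[@minkowski_add _/[set 0%R]]_(i < n) A%MK) : minkowski_scope.
Notation "\sum_ ( i 'in' S ) A" :=
  (\big[@minkowski_add _/[set 0%R]]_(i in S) A%MK) : minkowski_scope.

(* minimize objective k  subject to  ineq k <= 0, eqc k = 0, cG k >= 0,
   cH k >= 0, <cG k, cH k> = 0  (componentwise inequalities) *)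
Record mpec (R : realType) (n p q m : nat) := Mpec {
  objective : 'rV[R]_n -> R;
  ineq : 'rV[R]_n -> 'rV[R]_p;
  eqc : 'rV[R]_n -> 'rV[R]_q;
  cG : 'rV[R]_n -> 'rV[R]_m;
  cH : 'rV[R]_n -> 'rV[R]_m
}.

Section MPEC.
Variables (R : realType) (n p q m : nat) (P : mpec R n p q m).
Implicit Types k : 'rV[R]_n.

Definition feasible k : Prop :=
  [/\ forall i, component (ineq P) i k <= 0,
      eqc P k = 0,
      forall i, 0 <= component (cG P) i k,
      forall i, 0 <= component (cH P) i k &
      dotprod (cG P k) (cH P k) = 0].

Definition global_optimal_solution k : Prop :=
  feasible k /\ forall t, feasible t -> objective P k <= objective P t.

Definition active_ineq k : {set 'I_p} :=
  [set i | component (ineq P) i k == 0]%SET.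

Definition Theta k : {set 'I_m} :=
  [set i | (component (cG P) i k == 0) && (0 < component (cH P) i k)]%SET.

Definition Omega k : {set 'I_m} :=
  [set i | (component (cG P) i k == 0) && (component (cH P) i k == 0)]%SET.

Definition Upsilon k : {set 'I_m} :=
  [set i | (0 < component (cG P) i k) && (component (cH P) i k == 0)]%SET.

Definition OmegaG k (muG muH : 'rV[R]_m) : {set 'I_m} :=
  [set i in Omega k | (muH 0 i == 0) && (0 < muG 0 i)]%SET.

Definition OmegaH k (muG muH : 'rV[R]_m) : {set 'I_m} :=
  [set i in Omega k | (muG 0 i == 0) && (0 < muH 0 i)]%SET.

Definition ThetaPlus k (muG : 'rV[R]_m) : {set 'I_m} :=
  [set i in Theta k | 0 < muG 0 i]%SET.

Definition UpsilonPlus k (muH : 'rV[R]_m) : {set 'I_m} :=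
  [set i in Upsilon k | 0 < muH 0 i]%SET.

Local Notation "''dT' f" := (tangential_subdiff f) (at level 9, f at level 8).

Definition GA_set k (laml : 'rV[R]_p) (lamh : 'rV[R]_q) (lamG lamH : 'rV[R]_m)
    (muh : 'rV[R]_q) (muG muH : 'rV[R]_m) : set 'rV[R]_n :=
  ('dT (objective P) k
   + \sum_(i in active_ineq k) (laml 0 i *: 'dT (component (ineq P) i) k)
   + \sum_(j < q) (lamh 0 j *: 'dT (component (eqc P) j) k
                   + muh 0 j *: 'dT (\- component (eqc P) j)%R k)
   + \sum_(i < m) (lamG 0 i *: 'dT (\- component (cG P) i)%R k
                   + lamH 0 i *: 'dT (\- component (cH P) i)%R k)
   + \sum_(i < m) (muG 0 i *: 'dT (component (cG P) i) k
                   + muH 0 i *: 'dT (component (cH P) i) k))%MK.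

Definition GA_stationary k (laml : 'rV[R]_p) (lamh : 'rV[R]_q)
    (lamG lamH : 'rV[R]_m) (muh : 'rV[R]_q) (muG muH : 'rV[R]_m) : Prop :=
  [/\ feasible k,
      GA_set k laml lamh lamG lamH muh muG muH 0,
      [/\ forall i, i \in active_ineq k -> 0 <= laml 0 i,
          forall j, 0 <= lamh 0 j /\ 0 <= muh 0 j &
          forall i, [/\ 0 <= lamG 0 i, 0 <= lamH 0 i,
                        0 <= muG 0 i & 0 <= muH 0 i]],
      (forall i, i \in Upsilon k -> muG 0 i = 0 /\ lamG 0 i = 0) /\
      (forall i, i \in Theta k -> muH 0 i = 0 /\ lamH 0 i = 0) &
      forall i, i \in Omega k -> muG 0 i = 0 \/ muH 0 i = 0].

End MPEC.

(* Main.v *)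
(* If a feasible t had J t < J k, pair the GA-stationarity inclusion with t - k.
   Pseudoconvexity makes the contribution of the objective negative.  Since the
   four index sets are empty, all the multipliers muG and muH vanish, and every
   surviving term belongs to a function that is quasiconvex and equal to 0 at k,
   and <= 0 at t; it therefore contributes at most 0.  The sum would be 0 < 0. *)
Require Import Defs.
From mathcomp Require Import all_boot all_order all_algebra.
From mathcomp Require Import reals.
From mathcomp Require Import lra.

Import Order.TTheory GRing.Theory Num.Theory.
Local Open Scope ring_scope.

Lemma dotprod0l {R : realType} {n : nat} (v : 'rV[R]_n) : dotprod 0 v = 0.
Proof. by rewrite /dotprod big1 // => i _; rewrite mxE mul0r. Qed.

Lemma dotprodDl {R : realType} {n : nat} (u w v : 'rV[R]_n) :
  dotprod (u + w) v = dotprod u v + dotprod w v.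
Proof.
by rewrite /dotprod -big_split; apply: eq_bigr => i _; rewrite mxE mulrDl.
Qed.

Lemma dotprodZl {R : realType} {n : nat} (a : R) (u v : 'rV[R]_n) :
  dotprod (a *: u) v = a * dotprod u v.
Proof.
by rewrite /dotprod mulr_sumr; apply: eq_bigr => i _; rewrite mxE mulrA.
Qed.

(** That is, [v] lies in the polar cone of [A]. This property is stable under Minkowski sums and
    nonnegative scaling, so it can be checked on each term of the stationarity inclusion
    separately. *)
Definition polar {R : realType} {n : nat} (v : 'rV[R]_n)
    (A : classical_sets.set 'rV[R]_n) : Prop :=
  forall x, A x -> dotprod x v <= 0.

Lemma polar0 {R : realType} {n : nat} (v : 'rV[R]_n) :
  polar v (classical_sets.set1 0).
Proof. by move=> x ->; rewrite dotprod0l. Qed.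

Lemma polarD {R : realType} {n : nat} {v : 'rV[R]_n}
    {A B : classical_sets.set 'rV[R]_n} :
  polar v A -> polar v B -> polar v (minkowski_add A B).
Proof.
move=> pA pB _ [a Aa [b Bb <-]].
by rewrite dotprodDl; have := lerD (pA _ Aa) (pB _ Bb); rewrite addr0.
Qed.

(** The guard [a != 0] matches the convention that a zero multiplier yields the set {0}: nothing has
    to be known about [A] in that case. *)
Lemma polarZ {R : realType} {n : nat} {v : 'rV[R]_n} {a : R}
    {A : classical_sets.set 'rV[R]_n} :
  0 <= a -> (a != 0 -> polar v A) -> polar v (minkowski_scale a A).
Proof.
move=> a_ge0 pA; rewrite /minkowski_scale; case: eqVneq => [_|a_neq0].
  exact: polar0.
by move=> _ [x Ax <-]; rewrite dotprodZl mulr_ge0_le0 // pA.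
Qed.

Lemma polar_sum {R : realType} {n : nat} {v : 'rV[R]_n}
    {I : finType} {S : pred I} {F : I -> classical_sets.set 'rV[R]_n} :
  (forall i, S i -> polar v (F i)) ->
  polar v (\big[@minkowski_add _/classical_sets.set1 0]_(i | S i) F i).
Proof.
by apply: (big_ind (polar v)); [exact: polar0 | move=> A B; exact: polarD].
Qed.

Lemma quasiconvex_polar {R : realType} {n : nat} {f : 'rV[R]_n -> R}
    {k t : 'rV[R]_n} :
  tangentially_quasiconvex f k -> f t <= f k ->
  polar (t - k) (tangential_subdiff f k).
Proof. by move=> [_ qc] /qc. Qed.

(** A vanishing sum of nonnegative products has every product zero, so for each [i] one of the two
    factors vanishes. *)
Lemma feasible_complementarity {R : realType} {n p q m : nat}
    {P : mpec R n p q m} {k : 'rV[R]_n} (i : 'I_m) :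
  feasible P k -> [|| i \in Theta P k, i \in Omega P k | i \in Upsilon P k].
Proof.
case=> _ _ G_ge0 H_ge0 GH0; rewrite !inE.
have /eqP : component (cG P) i k * component (cH P) i k = 0.
  by apply: (psumr_eq0P _ GH0) => // j _; apply: mulr_ge0;
    [exact: G_ge0 | exact: H_ge0].
rewrite mulf_eq0 !lt0r G_ge0 H_ge0 !andbT.
by do 2!case: (_ == 0).
Qed.

(** Stationarity kills one of the two multipliers at each index, by sign class; if the other were
    positive, the index would belong to one of the four empty sets. *)
Lemma vanishing_mu {R : realType} {n p q m : nat} {P : mpec R n p q m}
    {k : 'rV[R]_n} {laml : 'rV[R]_p} {lamh : 'rV[R]_q} {lamG lamH : 'rV[R]_m}
    {muh : 'rV[R]_q} {muG muH : 'rV[R]_m} :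
  GA_stationary P k laml lamh lamG lamH muh muG muH ->
  OmegaG P k muG muH :|: OmegaH P k muG muH
    :|: ThetaPlus P k muG :|: UpsilonPlus P k muH = set0 ->
  forall i, muG 0 i = 0 /\ muH 0 i = 0.
Proof.
move=> [kF _ [_ _ sgn] [ups the] ome] /setP mu0 i.
have [_ _ muG_ge0 muH_ge0] := sgn i.
have := mu0 i; rewrite in_setU in_setU in_setU in_set0.
rewrite [i \in OmegaG _ _ _ _]in_set [i \in OmegaH _ _ _ _]in_set.
rewrite [i \in ThetaPlus _ _ _]in_set [i \in UpsilonPlus _ _ _]in_set.
(* As the multipliers are nonnegative, positivity reduces to being nonzero, and a boolean case
   analysis finishes each class. *)
rewrite !lt0r muG_ge0 muH_ge0 !andbT.
case/or3P: (feasible_complementarity i kF) => iS; rewrite iS /=.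
- have [-> _] := the _ iS.
  by rewrite eqxx /= !andbF /= orbC; case: (muG 0 i =P 0) => //=; rewrite ?orbT.
- have [->|->] := ome _ iS; rewrite eqxx /=.
    by case: (muH 0 i =P 0) => //=; rewrite ?orbT.
  by case: (muG 0 i =P 0) => //=; rewrite ?orbT.
- have [-> _] := ups _ iS.
  by rewrite eqxx /= !andbF /=; case: (muH 0 i =P 0) => //=; rewrite ?orbT.
Qed.

Theorem theorem5 (R : realType) (n p q m : nat) (P : mpec R n p q m)
    (k : 'rV[R]_n)
    (laml : 'rV[R]_p) (lamh : 'rV[R]_q) (lamG lamH : 'rV[R]_m)
    (muh : 'rV[R]_q) (muG muH : 'rV[R]_m)
    (tc_obj : tangentially_convex (objective P) k)
    (tc_ineq : forall i, tangentially_convex (component (ineq P) i) k)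
    (tc_eqc : forall j, tangentially_convex (component (eqc P) j) k)
    (tc_cG : forall i, tangentially_convex (component (cG P) i) k)
    (tc_cH : forall i, tangentially_convex (component (cH P) i) k)
    (tc_opp_eqc : forall j, tangentially_convex (\- component (eqc P) j) k)
    (tc_opp_cG : forall i, tangentially_convex (\- component (cG P) i) k)
    (tc_opp_cH : forall i, tangentially_convex (\- component (cH P) i) k)
    (Omega_neq0 : Omega P k != set0)
    (k_feasible : feasible P k)
    (k_GA : GA_stationary P k laml lamh lamG lamH muh muG muH)
    (pc_obj : tangentially_pseudoconvex (objective P) k)
    (qc_ineq : forall i, i \in active_ineq P k ->
       tangentially_quasiconvex (component (ineq P) i) k)
    (qc_eqc : forall j, tangentially_quasiconvex (component (eqc P) j) k)
    (qc_opp_eqc : forall j,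
       tangentially_quasiconvex (\- component (eqc P) j) k)
    (qc_opp_cG : forall i, i \in Theta P k :|: Omega P k ->
       tangentially_quasiconvex (\- component (cG P) i) k)
    (qc_opp_cH : forall i, i \in Upsilon P k :|: Omega P k ->
       tangentially_quasiconvex (\- component (cH P) i) k)
    (mu_sets_empty : OmegaG P k muG muH :|: OmegaH P k muG muH
       :|: ThetaPlus P k muG :|: UpsilonPlus P k muH = set0) :
  global_optimal_solution P k.
Proof.
split=> // t [t_ineq t_eqc t_G t_H _]; rewrite leNgt; apply/negP => Jt.
have mu0 := vanishing_mu k_GA mu_sets_empty.
have [_ k_eqc _ _ _] := k_feasible.
case: k_GA => _ GA [laml_ge0 lamh_ge0 sgn] [ups the] _.
(* The summands of 0: [xi] from the objective, [b] from the inequalities, [c] from the equalities,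
   [d] from the [lamG], [lamH] terms and [e] from the [muG], [muH] terms. *)
case: GA => _ [_ [_ [xi xiJ [b bS <-]] [c cS <-]] [d dS <-]] [e eS GA0].
have xi_lt0 : dotprod xi (t - k) < 0 by case: pc_obj => _; apply.
have b_le0 : dotprod b (t - k) <= 0.
  apply: polar_sum bS => i iI; apply: polarZ => [|_]; first exact: laml_ge0.
  apply: quasiconvex_polar; first exact: qc_ineq.
  by move: iI; rewrite inE => /eqP ->.
have c_le0 : dotprod c (t - k) <= 0.
  apply: polar_sum cS => j _; have [lam_ge0 mu_ge0] := lamh_ge0 j.
  (* Each equality constraint vanishes at both [t] and [k], so quasiconvexity applies to it and to
     its opposite alike. *)
  apply: polarD; apply: polarZ => // _; apply: quasiconvex_polar => //.
    by rewrite /component t_eqc k_eqc.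
  by rewrite /component /= t_eqc k_eqc.
have d_le0 : dotprod d (t - k) <= 0.
  apply: polar_sum dS => i _; have [lamG_ge0 lamH_ge0 _ _] := sgn i.
  apply: polarD; apply: polarZ => // lam_neq0.
  (* A nonzero [lamG] rules out [Upsilon], which leaves exactly the indices where [cG] vanishes at
     [k] and its opposite is quasiconvex. *)
  - have iS : i \in Theta P k :|: Omega P k.
      rewrite in_setU; case/or3P: (feasible_complementarity i k_feasible) => iS;
        rewrite ?iS ?orbT //.
      by have [_ lam0] := ups _ iS; rewrite lam0 eqxx in lam_neq0.
    apply: quasiconvex_polar; first exact: qc_opp_cG.
    have -> : (\- component (cG P) i)%R k = 0.
      by move: iS; rewrite !inE /= -andb_orr => /andP[/eqP -> _]; rewrite oppr0.
    by rewrite /= oppr_le0.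
  - have iS : i \in Upsilon P k :|: Omega P k.
      rewrite in_setU; case/or3P: (feasible_complementarity i k_feasible) => iS;
        rewrite ?iS ?orbT //.
      by have [_ lam0] := the _ iS; rewrite lam0 eqxx in lam_neq0.
    apply: quasiconvex_polar; first exact: qc_opp_cH.
    have -> : (\- component (cH P) i)%R k = 0.
      by move: iS; rewrite !inE /= -andb_orl => /andP[_ /eqP ->]; rewrite oppr0.
    by rewrite /= oppr_le0.
have e_le0 : dotprod e (t - k) <= 0.
  apply: polar_sum eS => i _; have [muG0 muH0] := mu0 i.
  (* With zero multipliers the guard in [polarZ] is false, so no convexity of [cG] or [cH]
     themselves is called for. *)
  by apply: polarD; apply: polarZ; rewrite ?muG0 ?muH0 ?eqxx.
have := congr1 (fun x => dotprod x (t - k)) GA0.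
rewrite !dotprodDl dotprod0l; lra.
Qed.
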